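(* Let $m=\mathrm{poly}(n)$ with $m>cn$ for some constant $c>1$, and let $p=\omega(1/n)$. Let $\mathbf A\in\mathbb{Z}_2^{2n\times n}$ be a uniformly random full-rank isotropic matrix and let $\mathbf B\in\mathbb{Z}_2^{m\times2n}$ be a random variable independent of $\mathbf A$ such that $\mathbf B\mathbf A\in\mathbb{Z}_2^{m\times n}$ is within negligible total variation distance of a uniformly random matrix. Fix any $\delta>0$ and let $r:=n/m$. Then $\Pr_{\mathbf B}\Big[\mathbb{E}_{\mathbf e\sim\mathcal{D}_p^{\otimes n}}[|\mathbf B\mathbf e|]\ge\tfrac{1-r-\delta}{2}\,m\Big]\ge1-\mathrm{negl}(n),$ where $|\cdot|$ denotes Hamming weight and $\mathbf e$ is independent of $\mathbf B$.
   Context: Symplectic inner product on $\mathbb{Z}_2^{2n}$: $(\mathbf a,\mathbf b)\odot(\mathbf a',\mathbf b')=\mathbf a\cdot\mathbf b'+\mathbf a'\cdot\mathbf b\pmod2$. A uniformly random full-rank isotropic matrix in $\mathbb{Z}_2^{2n\times n}$ is uniform among matrices of column rank $n$ with pairwise symplectically orthogonal columns. $\mathcal{D}_p^{\otimes n}$: random $\mathbf e\in\mathbb{Z}_2^{2n}$ with independent pairs $(e_j,e_{n+j})$, each $(0,0)$ w.p. $1-p$ and each of $(0,1),(1,0),(1,1)$ w.p. $p/3$. *)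

(* Defs.v *)
From mathcomp Require Import all_boot all_order all_algebra.
From mathcomp Require Import reals.
Set Implicit Arguments. Unset Strict Implicit. Unset Printing Implicit Defensive.
Import Order.TTheory GRing.Theory Num.Theory.
Local Open Scope ring_scope.

Definition F2 := 'F_2.

(* Vectors of Z_2^{2n} are columns indexed by 'I_(n+n); index j (j<n) is
   lshift n j and index n+j is rshift n j. *)
Definition symp (n : nat) (u v : 'cV[F2]_(n + n)) : F2 :=
  \sum_(j < n) (u (lshift n j) 0 * v (rshift n j) 0
                + u (rshift n j) 0 * v (lshift n j) 0).

Definition fullrank_isotropic (n : nat) (A : 'M[F2]_(n + n, n)) : bool :=
  (\rank A == n) && [forall i, forall j, symp (col i A) (col j A) == 0].

Definition unif_iso (R : realType) (n : nat) (A : 'M[F2]_(n + n, n)) : R :=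
  if fullrank_isotropic A
  then (#|[set A' : 'M[F2]_(n + n, n) | fullrank_isotropic A']|%:R)^-1
  else 0.

Definition is_distr (R : realType) (T : finType) (P : {ffun T -> R}) : Prop :=
  (forall x, 0 <= P x) /\ \sum_x P x = 1.

Definition law_BA (R : realType) (m n : nat) (PB : {ffun 'M[F2]_(m, n + n) -> R})
  (M : 'M[F2]_(m, n)) : R :=
  \sum_(B : 'M[F2]_(m, n + n)) \sum_(A : 'M[F2]_(n + n, n))
     PB B * unif_iso R A * (B *m A == M)%:R.

Definition tvd (R : realType) (T : finType) (P Q : T -> R) : R :=
  2^-1 * \sum_(x : T) `|P x - Q x|.

Definition pair_weight (R : realType) (p : R) (a b : F2) : R :=
  if (a == 0) && (b == 0) then 1 - p else p / 3.

Definition Dp (R : realType) (n : nat) (p : R) (e : 'cV[F2]_(n + n)) : R :=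
  \prod_(j < n) pair_weight p (e (lshift n j) 0) (e (rshift n j) 0).

Definition hamming (m : nat) (v : 'cV[F2]_m) : nat := #|[set i | v i 0 != 0]|.

Definition exp_weight (R : realType) (m n : nat) (p : R) (B : 'M[F2]_(m, n + n)) : R :=
  \sum_(e : 'cV[F2]_(n + n)) Dp p e * (hamming (B *m e))%:R.

Definition negligible (R : realType) (f : nat -> R) : Prop :=
  forall k : nat, exists N : nat, forall n : nat, (N <= n)%N ->
    `|f n| <= (n%:R ^+ k)^-1.

Definition poly_bounded (m : nat -> nat) : Prop :=
  exists k N : nat, forall n : nat, (N <= n)%N -> (m n <= n ^ k)%N.

Definition omega_inv_n (R : realType) (p : nat -> R) : Prop :=
  forall K : R, exists N : nat, forall n : nat, (N <= n)%N -> K <= p n * n%:R.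

(* Main.v *)
Require Import Defs.
From mathcomp Require Import all_boot all_order all_algebra all_fingroup.
From mathcomp Require Import reals.
From mathcomp Require Import zify ring lra.
Import Order.TTheory GRing.Theory Num.Theory.
Set Implicit Arguments. Unset Strict Implicit. Unset Printing Implicit Defensive.
Local Open Scope ring_scope.

(** A row touching w of the n coordinate pairs contributes
    (1 - (1 - 4p/3)^w)/2 to the expected weight, which tends to 1/2 as soon as w
    is linear in n.  So it suffices that, outside a negligible event, at most
    n + m/D rows of B touch few pairs.

    Suppose k = n + s low rows form a submatrix B' of rank d.  Every M = B'A has
    its columns in the column space of B', leaving at most 2^(dn) candidates:
    few if d <= n + s/2.  If d is larger, the Gram matrix G = B' J B'^T has rank
    at least 2d - 2n > s, and since the left kernel of A is isotropic, the left
    kernel of M, of dimension at least s, is isotropic for G; this has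
    probability 2^(-Omega(s^2)) for uniform M.  Low vectors number only
    2^(o(1) n), so a union bound over the position and the entries of B' shows
    that the products BA with B having too many low rows form a
    2^(-n)-fraction of all matrices, whereas BA is nearly uniform. *)

(** * Counting matrices over a finite field *)

Lemma card_preim_le (aT rT : finType) (f : aT -> rT) (P : {set rT}) (c : nat) :
  (forall y, y \in P -> (#|[set x | f x == y]| <= c)%N) ->
  (#|[set x | f x \in P]| <= #|P| * c)%N.
Proof.
move=> fib; rewrite -sum1_card (partition_big f (mem P)) /=; last first.
  by move=> x; rewrite inE.
rewrite -sum_nat_const; apply: leq_sum => y yP.
apply: leq_trans (fib y yP); rewrite -sum1_card; apply/eq_leq/eq_bigl => x.
by rewrite !inE andb_idl // => /eqP ->.
Qed.

Section MatrixCounting.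
Variable F : finFieldType.
Local Notation q := #|F|.

Lemma card_submx (a b c : nat) (V : 'M[F]_(c, a)) :
  #|[set X : 'M[F]_(b, a) | (X <= V)%MS]| = (q ^ (b * \rank V))%N.
Proof.
rewrite -card_mx -(card_imset predT (row_free_inj (row_base_free V) (m := b))).
apply/eq_card => X; rewrite inE; apply/idP/imsetP.
  by rewrite -(eq_row_base V) => /submxP[D ->]; exists D.
by case=> D _ ->; rewrite -(eq_row_base V) submxMl.
Qed.

Lemma card_annl (a b c : nat) (C : 'M[F]_(a, c)) :
  #|[set X : 'M[F]_(b, a) | X *m C == 0]| = (q ^ (b * (a - \rank C)))%N.
Proof.
rewrite -mxrank_ker -card_submx; apply/eq_card => X.
by rewrite !inE sub_kermx.
Qed.

Lemma card_annr (a b c : nat) (C : 'M[F]_(c, a)) :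
  #|[set X : 'M[F]_(a, b) | C *m X == 0]| = (q ^ (b * (a - \rank C)))%N.
Proof.
rewrite -mxrank_tr -card_annl -(card_imset _ (can_inj (@trmxK _ a b))).
apply/eq_card => X; rewrite inE; apply/imsetP/eqP.
  by case=> Y; rewrite inE => /eqP CY0 ->; rewrite -trmx_mul CY0 trmx0.
by move=> XC0; exists X^T; rewrite ?trmxK // inE -[C]trmxK -trmx_mul XC0 trmx0.
Qed.

Lemma card_fiber_mulmxr (a b c : nat) (C : 'M[F]_(a, c)) (Z : 'M[F]_(b, c)) :
  (#|[set X : 'M[F]_(b, a) | X *m C == Z]| <= q ^ (b * (a - \rank C)))%N.
Proof.
have [->|[X0]] := set_0Vmem [set X : 'M[F]_(b, a) | X *m C == Z].
  by rewrite cards0.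
rewrite inE => /eqP X0C; rewrite -card_annl.
rewrite -(card_imset _ (addIr (- X0))); apply/subset_leq_card/subsetP => Y.
by case/imsetP=> X; rewrite !inE => /eqP XC ->; rewrite mulmxBl XC X0C subrr.
Qed.

(** A matrix of rank at most [u] factors through dimension [u], so it is determined by an [h] by [u]
    and a [u] by [g] factor. *)
Lemma card_rank_le (h g u : nat) :
  (#|[set X : 'M[F]_(h, g) | \rank X <= u]| <= q ^ (u * (h + g)))%N.
Proof.
pose mul (CD : 'M[F]_(h, u) * 'M[F]_(u, g)) := CD.1 *m CD.2.
have -> : (q ^ (u * (h + g)) = #|{: 'M[F]_(h, u) * 'M[F]_(u, g)}|)%N.
  by rewrite card_prod !card_mx mulnDr expnD [(u * h)%N]mulnC.
apply: leq_trans (leq_imset_card mul predT); apply/subset_leq_card/subsetP => X.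
rewrite inE => rXu; apply/imsetP.
(* The [pid_mx] factors pad the rank factorization to inner dimension exactly [u]. *)
exists (col_base X *m pid_mx u, pid_mx u *m row_base X) => //.
rewrite /mul /= mulmxA -(mulmxA (col_base X)) mul_pid_mx !minnn -pid_mx_minv.
by rewrite (minn_idPl rXu) pid_mx_1 mulmx1 mulmx_base.
Qed.

(** Replacing [G] by [col_base G] keeps the rank of the product and leaves [\rank G] columns;
    [card_rank_le] then counts the products, and each nonempty fiber is a coset of an
    annihilator. *)
Lemma card_rank_mulmx_le (h k l u : nat) (G : 'M[F]_(k, l)) :
  (#|[set X : 'M[F]_(h, k) | \rank (X *m G) <= u]|
     <= q ^ (u * (h + \rank G) + h * (k - \rank G)))%N.
Proof.
pose P := [set Y : 'M[F]_(h, \rank G) | (\rank Y <= u)%N].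
have -> : [set X : 'M[F]_(h, k) | \rank (X *m G) <= u]%N =
          [set X | X *m col_base G \in P].
  apply/setP => X; rewrite !inE -{1}[G]mulmx_base mulmxA.
  by rewrite mxrankMfree ?row_base_free.
rewrite expnD; apply: leq_trans (leq_mul (card_rank_le _ _ _) (leqnn _)).
apply: card_preim_le => Y _.
apply: leq_trans (card_fiber_mulmxr _ _) _.
by rewrite (eqP (col_base_full G)).
Qed.

(** Cutting [W] into X above Y and keeping only X G Y^T = 0 turns a quadratic condition into one
    linear in Y. The first summand counts the X for which X G has rank at most [u], with Y free; for
    the other X, each row of Y lies in a space of codimension above [u]. *)
Lemma card_self_annihilating (h h' k u : nat) (G : 'M[F]_k) :
  (#|[set W : 'M[F]_(h + h', k) | W *m G *m W^T == 0%R]|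
     <= q ^ (u * (h + \rank G) + h * (k - \rank G) + h' * k)
        + q ^ (h * k + h' * (k - u)))%N.
Proof.
pose split (W : 'M[F]_(h + h', k)) := (usubmx W, dsubmx W).
have split_inj : injective split.
  by move=> W W' [eu ed]; rewrite -[W]vsubmxK eu ed vsubmxK.
pose S := [set XY : 'M[F]_(h, k) * 'M[F]_(h', k) | XY.1 *m G *m XY.2^T == 0].
apply: (@leq_trans #|S|).
  rewrite -(card_imset _ split_inj); apply/subset_leq_card/subsetP => XY.
  case/imsetP=> W; rewrite inE => /eqP W0 ->; rewrite inE /=; apply/eqP.
  move: W0; rewrite -{1 2}[W]vsubmxK mul_col_mx tr_col_mx mul_col_row.
  by rewrite -block_mx0 => /eq_block_mx[_].
have fibX X : #|[set Y : 'M[F]_(h', k) | X *m G *m Y^T == 0]|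
              = (q ^ (h' * (k - \rank (X *m G))))%N.
  rewrite -card_annr -(card_imset _ (can_inj (@trmxK _ k h'))).
  apply/eq_card => Y; rewrite inE; apply/idP/imsetP.
    by move=> YG; exists Y^T; rewrite ?trmxK // inE.
  by case=> Z; rewrite inE => YG ->; rewrite trmxK.
have -> : #|S| = (\sum_(X : 'M[F]_(h, k)) q ^ (h' * (k - \rank (X *m G))))%N.
  rewrite -sum1_card; under eq_bigl do rewrite inE.
  under [RHS]eq_bigr do rewrite -fibX -sum1_card.
  rewrite pair_big_dep /=; apply: eq_bigl => -[X Y]; by rewrite !inE.
have q0 : (0 < q)%N by apply/card_gt0P; exists 0.
rewrite (bigID (fun X => \rank (X *m G) <= u)%N) /=; apply: leq_add.
  apply: leq_trans (_ : (\sum_(X : 'M[F]_(h, k) | (\rank (X *m G) <= u)%N) q ^ (h' * k) <= _)%N).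
    by apply: leq_sum => X _; rewrite leq_pexp2l // leq_mul2l leq_subr orbT.
  rewrite expnD sum_nat_const leq_mul2r -cardsE; apply/orP; right.
  exact: card_rank_mulmx_le.
apply: leq_trans (_ : (\sum_(X : 'M[F]_(h, k)) q ^ (h' * (k - u)) <= _)%N).
  rewrite [X in (_ <= X)%N](bigID (fun X => \rank (X *m G) <= u)%N) /=.
  apply: leq_trans (leq_addl _ _); apply: leq_sum => X; rewrite -ltnNge => uX.
  by rewrite leq_pexp2l // leq_mul2l leq_sub2l ?orbT // ltnW.
by rewrite sum_nat_const card_mx expnD.
Qed.

(** The order of GL_s is q^C(s,2) times the product of the q^i - 1 for i from 1 to s, and q^i - 1 is
    at least q^(i-1). *)
Lemma card_unitmx_ge (s : nat) :
  (0 < s)%N -> (q ^ (s * s - s) <= #|[set g : 'M[F]_s | g \in unitmx]|)%N.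
Proof.
case: s => // s _; have q1 : (1 < q)%N := card_finNzRing_gt1 F.
apply: (@leq_trans #|'GL_s.+1[F]%g|); last first.
  rewrite -(card_imset _ (val_inj : injective (@GLval s.+1 F))).
  by apply/subset_leq_card/subsetP => _ /imsetP[g _ ->]; rewrite inE; exact: (GL_unitmx g).
rewrite card_GL //.
have -> : (s.+1 * s.+1 - s.+1 = 'C(s.+1, 2) + 'C(s.+1, 2))%N.
  by have := mul_bin_diag s.+1 1; rewrite bin1 /=; lia.
rewrite expnD leq_mul2l -triangular_sum expn_sum; apply/orP; right.
rewrite big_add1 /=; apply: leq_prod => i _.
have /leq_ltn_trans/(_ (ltn_expl i q1)) qi := leq0n i.
by rewrite subn1 expnS -ltnS prednK ?muln_gt0 ?qi ?(ltnW q1) // ltn_Pmull.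
Qed.

(** The left kernel of [M] contains [s] independent rows; multiplying them by the invertible
    matrices of size [s] gives distinct solutions. *)
Lemma card_row_free_annl (s k n : nat) (M : 'M[F]_(k, n)) :
  (0 < s)%N -> (s + n <= k)%N ->
  (q ^ (s * s - s) <= #|[set W : 'M[F]_(s, k) | row_free W && (W *m M == 0%R)]|)%N.
Proof.
move=> s0 snk; apply: leq_trans (card_unitmx_ge s0) _.
have rk : (s <= \rank (kermx M))%N.
  by rewrite mxrank_ker; have := rank_leq_col M; lia.
pose K : 'M[F]_(s, k) := pid_mx s *m row_base (kermx M).
have Kfree : row_free K.
  by rewrite /row_free /K mxrankMfree ?row_base_free // rank_pid_mx.
have KM : K *m M = 0.
  apply/eqP; rewrite -sub_kermx.
  by apply: submx_trans (submxMl _ _) _; rewrite eq_row_base.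
rewrite -(card_imset _ (row_free_inj Kfree (m := s))).
apply/subset_leq_card/subsetP => W /imsetP[g]; rewrite inE => gu ->.
rewrite inE -mulmxA KM mulmx0 eqxx andbT /row_free mxrankMfree //.
by rewrite -/(row_free g) row_free_unit.
Qed.

(* Double counting of the pairs (W, M) with W row-free and W M = 0. *)
Lemma card_isotropic_kernel (s n : nat) (G : 'M[F]_(s + n)) (Q : {set 'M[F]_(s + n, n)}) :
  (0 < s)%N ->
  (forall M, M \in Q -> forall W : 'M[F]_(s, s + n), W *m M = 0 ->
     W *m G *m W^T = 0) ->
  (#|Q| * q ^ (s * s - s)
     <= #|[set W : 'M[F]_(s, s + n) | W *m G *m W^T == 0%R]| * q ^ (n * n))%N.
Proof.
move=> s0 Qker; set N := [set W | _].
pose S := [set WM : 'M[F]_(s, s + n) * 'M[F]_(s + n, n) |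
  [&& WM.2 \in Q, row_free WM.1 & WM.1 *m WM.2 == 0]].
have le1 : (#|Q| * q ^ (s * s - s) <= #|S|)%N.
  rewrite -(sum1_card (mem S)) (partition_big (fun WM => WM.2) (mem Q)) /=; last first.
    by move=> WM; rewrite inE => /and3P[].
  rewrite -sum_nat_const; apply: leq_sum => M MQ.
  apply: leq_trans (card_row_free_annl M s0 (leqnn _)) _.
  rewrite sum1dep_card -(card_imset _ (_ : injective (fun W : 'M_(s, s + n) => (W, M)))); last first.
    by move=> W W' [].
  apply/subset_leq_card/subsetP => WM' /imsetP[W]; rewrite inE => /andP[Wf WM] ->.
  by rewrite !inE /= MQ Wf WM eqxx.
apply: leq_trans le1 _.
rewrite -(sum1_card (mem S)) (partition_big (fun WM => WM.1) (mem N)) /=; last first.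
  case=> W M; rewrite !inE /= => /and3P[MQ _ /eqP WM0]; apply/eqP.
  exact: (Qker M).
rewrite -sum_nat_const; apply: leq_sum => W _.
have [Wf|Wnf] := boolP (row_free W); last first.
  rewrite big1 // => -[W' M]; rewrite inE /= => /andP[/and3P[_ W'f _] /eqP eW].
  by rewrite eW (negPf Wnf) in W'f.
(* Other side of the double count: a row-free [W] annihilates exactly q^(n*n) matrices. *)
have -> : (n * n = n * (s + n - \rank W))%N by rewrite (eqP Wf) addKn.
rewrite -card_annr sum1dep_card -(card_imset _ (_ : injective (fun M : 'M_(s + n, n) => (W, M)))); last first.
  by move=> M M' [].
apply/subset_leq_card/subsetP => -[W' M]; rewrite !inE /= => /andP[/and3P[_ _ W'M] /eqP eW].
by apply/imsetP; exists M; rewrite ?inE -eW.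
Qed.

End MatrixCounting.

(** * Products with isotropic matrices *)

Lemma card_F2 : #|F2| = 2%N.
Proof. exact: card_Fp. Qed.

Definition symp_mx (n : nat) : 'M[F2]_(n + n) := block_mx 0 1%:M 1%:M 0.

Lemma symp_mxE (n : nat) (u v : 'cV[F2]_(n + n)) :
  symp u v = (u^T *m symp_mx n *m v) 0 0.
Proof.
rewrite -[u in RHS]vsubmxK -[v in RHS]vsubmxK tr_col_mx mul_row_block.
rewrite !mulmx0 !mulmx1 add0r addr0 mul_row_col !mxE -big_split /=.
by apply: eq_bigr => j _; rewrite !mxE addrC.
Qed.

Lemma symp_mxK (n : nat) : symp_mx n *m symp_mx n = 1%:M.
Proof.
by rewrite mulmx_block !mulmx0 !mul0mx !mulmx1 !addr0 !add0r -scalar_mx_block.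
Qed.

Lemma fullrank_isotropicP (n : nat) (A : 'M[F2]_(n + n, n)) :
  reflect (\rank A = n /\ A^T *m symp_mx n *m A = 0) (fullrank_isotropic A).
Proof.
have entry i j : (A^T *m symp_mx n *m A) i j = symp (col i A) (col j A).
  rewrite symp_mxE tr_col -row_mul !mxE; apply: eq_bigr => k _; by rewrite !mxE.
apply: (iffP andP) => -[/eqP rA isoA]; split=> //.
- apply/matrixP => i j; rewrite entry mxE.
  by apply/eqP; have /forallP/(_ i)/forallP/(_ j) := isoA.
- by apply/forallP=> i; apply/forallP=> j; rewrite -entry isoA mxE.
Qed.

(* The rows of A^T J span the left kernel of A, by a dimension count. *)
Lemma annihilator_isotropic (n a b : nat) (A : 'M[F2]_(n + n, n))
  (x : 'M[F2]_(a, n + n)) (y : 'M[F2]_(b, n + n)) :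
  fullrank_isotropic A -> x *m A = 0 -> y *m A = 0 ->
  x *m symp_mx n *m y^T = 0.
Proof.
case/fullrank_isotropicP => rA isoA /eqP xA yA.
have Ju : symp_mx n \in unitmx by case: (mulmx1_unit (symp_mxK n)).
have AJker : (A^T *m symp_mx n <= kermx A)%MS by rewrite sub_kermx isoA.
have rAJ : \rank (A^T *m symp_mx n) = n.
  by rewrite mxrankMfree ?row_free_unit // mxrank_tr.
have : (x <= A^T *m symp_mx n)%MS.
  apply: submx_trans (_ : (kermx A <= _)%MS); first by rewrite sub_kermx.
  by rewrite -(geq_leqif (mxrank_leqif_sup AJker)) rAJ mxrank_ker rA addnK.
case/submxP=> z ->; rewrite -!mulmxA (mulmxA (symp_mx n)) symp_mxK mul1mx.
by rewrite -trmx_mul yA trmx0 mulmx0.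
Qed.

(** Frobenius rank inequality for the triple product, the middle factor being invertible. *)
Lemma gram_rank (n k : nat) (B : 'M[F2]_(k, n + n)) :
  (\rank B + \rank B <= n + n + \rank (B *m symp_mx n *m B^T))%N.
Proof.
have Ju : symp_mx n \in unitmx by case: (mulmx1_unit (symp_mxK n)).
have rB : \rank (B *m symp_mx n) = \rank B by rewrite mxrankMfree ?row_free_unit.
have rBT : \rank (symp_mx n *m B^T) = \rank B.
  by rewrite eqmxMfull ?row_full_unit // mxrank_tr.
rewrite -{1}rB -{1}rBT; apply: leq_trans (mxrank_Frobenius _ _ _) _.
by rewrite leq_add2r rank_leq_row.
Qed.

Definition isotropic_images (n k : nat) (B : 'M[F2]_(k, n + n)) :
  {set 'M[F2]_(k, n)} :=
  [set B *m A | A : 'M[F2]_(n + n, n) & fullrank_isotropic A].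

(** The rows of [W *m B] lie in the left kernel of the [A] that produces [M], and this kernel is
    isotropic. *)
Lemma isotropic_images_kernel (s n k : nat) (B : 'M[F2]_(k, n + n))
  (M : 'M[F2]_(k, n)) (W : 'M[F2]_(s, k)) :
  M \in isotropic_images B -> W *m M = 0 ->
  W *m (B *m symp_mx n *m B^T) *m W^T = 0.
Proof.
case/imsetP=> A; rewrite inE => isoA -> WBA.
have WBA' : (W *m B) *m A = 0 by rewrite -mulmxA.
have := annihilator_isotropic isoA WBA' WBA'.
by rewrite trmx_mul !mulmxA.
Qed.

Lemma card_isotropic_images_rank (n k : nat) (B : 'M[F2]_(k, n + n)) :
  (#|isotropic_images B| <= 2 ^ (\rank B * n))%N.
Proof.
rewrite -[X in (X ^ _)%N]card_F2 -card_mx.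
apply: leq_trans (leq_imset_card (mulmx (col_base B)) predT).
apply/subset_leq_card/subsetP => M /imsetP[A _ ->]; apply/imsetP.
by exists (row_base B *m A); rewrite // mulmxA mulmx_base.
Qed.

Lemma card_self_annihilating_gram (s k f : nat) (G : 'M[F2]_k) :
  (s <= \rank G)%N -> (8 * f + 4 * s <= s * s)%N ->
  (#|[set W : 'M[F2]_(s, k) | W *m G *m W^T == 0%R]| * 2 ^ f
    <= 2 ^ (s * k).+1)%N.
Proof.
move=> sG fs; have Gk := rank_leq_row G.
(* Halving twice makes both exponents of [card_self_annihilating] fall short of [s * k] by at least
   [h * (h - 1) / 2], which dominates [f]. The successor in the goal absorbs the sum of the two
   terms. *)
pose h := s./2; pose u := h./2.
have es : (h + (s - h) = s)%N by rewrite /h; lia.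
have hs : (2 * h <= s <= 2 * h + 1)%N by rewrite /h; lia.
have uh : (2 * u <= h <= 2 * u + 1)%N by rewrite /u; lia.
have := card_self_annihilating h (s - h) u G; rewrite es card_F2.
set N := #|_|; move: (\rank G) sG Gk => g sG Gk.
move: {es}(s - h)%N (es) => h' es; clearbody N u h => leN.
have f1 : (2 * f <= h * (h - 1))%N by nia.
have esk : (s * k = h * k + h' * k)%N by rewrite -es mulnDl.
have le1 : (u * (h + g) + h * (k - g) + h' * k + f <= s * k)%N.
  have e1 : (h * (k - g) + h * g = h * k)%N by rewrite -mulnDr subnK.
  have e2 : (2 * (u * (h + g)) <= h * (h + g))%N by rewrite mulnA leq_mul2r; lia.
  have e3 : (h * (2 * h) <= h * g)%N by rewrite leq_mul2l; lia.
  lia.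
have le2 : (h * k + h' * (k - u) + f <= s * k)%N.
  have e1 : (h' * (k - u) + h' * u = h' * k)%N by rewrite -mulnDr subnK //; lia.
  have e2 : (h * (h - 1) <= h' * (2 * u))%N by apply: leq_mul; lia.
  lia.
apply: leq_trans (leq_mul leN (leqnn _)) _.
by rewrite mulnDl -!expnD expnS mul2n -addnn leq_add // leq_pexp2l.
Qed.

Lemma card_isotropic_images (s n k e : nat) (B : 'M[F2]_(k, n + n)) :
  (s + n)%N = k -> (2 * e <= s * n)%N -> (8 * (e + s + 1) + 4 * s <= s * s)%N ->
  (#|isotropic_images B| * 2 ^ e <= 2 ^ (n * k))%N.
Proof.
move=> ek; case: k / ek B => B esn es; have [dle|dgt] := leqP (\rank B + \rank B) (n + n + s).
  apply: leq_trans (leq_mul (card_isotropic_images_rank B) (leqnn _)) _.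
  by rewrite -expnD leq_pexp2l //; nia.
have s0 : (0 < s)%N by lia.
have sG : (s <= \rank (B *m symp_mx n *m B^T))%N by have := gram_rank B; lia.
have leN := card_self_annihilating_gram sG es.
have := card_isotropic_kernel s0 (fun M MQ W => @isotropic_images_kernel s n _ B M W MQ).
rewrite card_F2; set N := #|[set W | _]| in leN *; set Q := #|_| => leQ.
(* The gain obtained is [e + s + 1]: the [s] repays the loss in the exponent [s * s - s], and the 1
   repays the successor in [leN]. *)
rewrite -(@leq_pmul2r (2 ^ (s * s - s + (s + 1)))) ?expn_gt0 //.
apply: (@leq_trans (N * 2 ^ (e + s + 1) * 2 ^ (n * n))%N).
  rewrite mulnAC -addnA [(2 ^ (e + _))%N]expnD expnD.
  by have := leq_mul leQ (leqnn (2 ^ e * 2 ^ (s + 1))%N); congr (_ <= _)%N; ring.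
apply: leq_trans (leq_mul leN (leqnn _)) _.
by rewrite -!expnD leq_pexp2l //; nia.
Qed.

(** * Low-weight vectors *)

(** Distributivity after regrouping coordinates j and n+j. It serves both the generating function of
    support sizes and expectations under [Dp]. *)
Lemma sum_prod_pairs (R : comNzSemiRingType) (n : nat) (f : 'I_n -> F2 -> F2 -> R) :
  \sum_(e : 'cV[F2]_(n + n)) \prod_(j < n) f j (e (lshift n j) 0) (e (rshift n j) 0)
  = \prod_(j < n) \sum_(c : F2) \sum_(d : F2) f j c d.
Proof.
under [RHS]eq_bigr do rewrite pair_big /=.
rewrite bigA_distr_bigA /=.
pose col_of (g : {ffun 'I_n -> F2 * F2}) : 'cV[F2]_(n + n) :=
  col_mx (\col_j (g j).1) (\col_j (g j).2).
rewrite (reindex col_of) /=.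
  apply: eq_bigr => g _; apply: eq_bigr => j _.
  by rewrite col_mxEu col_mxEd !mxE.
exists (fun e : 'cV_(n + n) => [ffun j => (e (lshift n j) 0, e (rshift n j) 0)]).
  move=> g _; apply/ffunP => j.
  by rewrite ffunE col_mxEu col_mxEd !mxE -surjective_pairing.
move=> e _; rewrite -[e in RHS]vsubmxK; congr col_mx; apply/colP => j.
  by rewrite !mxE ffunE.
by rewrite !mxE ffunE.
Qed.

Lemma sum_F2 (R : nmodType) (f : F2 -> R) : \sum_(c : F2) f c = f 0 + f 1.
Proof.
rewrite (bigD1 0) // (bigD1 1) //= big1 ?addr0 // => c.
by case: c => [[|[|?]]].
Qed.

Definition pair_support (n : nat) (x : 'cV[F2]_(n + n)) : {set 'I_n} :=
  [set j | (x (lshift n j) 0 != 0) || (x (rshift n j) 0 != 0)].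

Definition low_vectors (n q : nat) : {set 'cV[F2]_(n + n)} :=
  [set x | #|pair_support x| * q <= n]%N.

(** Generating function: each pair contributes z when zero and 1 for each of its three nonzero
    values. *)
Lemma sum_pair_support (n z : nat) :
  (\sum_(x : 'cV[F2]_(n + n)) z ^ (n - #|pair_support x|) = (z + 3) ^ n)%N.
Proof.
pose f (j : 'I_n) (c d : F2) : nat := if (c != 0) || (d != 0) then 1%N else z.
transitivity (\sum_(x : 'cV[F2]_(n + n))
    \prod_(j < n) f j (x (lshift n j) 0%R) (x (rshift n j) 0%R))%N.
  apply: eq_bigr => x _; rewrite (bigID (mem (pair_support x))) /=.
  rewrite big1 => [|j]; last by rewrite inE /f => ->.
  rewrite mul1n (eq_bigr (fun=> z)) => [|j]; last by rewrite inE /f => /negPf ->.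
  rewrite prod_nat_const; congr (_ ^ _)%N.
  by rewrite -[X in (X - _)%N]card_ord -(cardC (mem (pair_support x))) addKn.
have /= -> := sum_prod_pairs f.
rewrite (eq_bigr (fun=> (z + 3)%N)) => [|j _].
  by rewrite prod_nat_const card_ord.
by rewrite sum_F2 !sum_F2 /f /=; ring.
Qed.

(* Chernoff: weight each vector by (2 ^ a) ^ (n - weight). *)
Lemma card_low_vectors (n a b : nat) :
  (0 < a * b)%N -> ((2 ^ a + 3) ^ b <= 2 ^ (a * b).+1)%N ->
  (#|low_vectors n (a * b)| ^ b <= 2 ^ (2 * n))%N.
Proof.
move=> q0 ab; set L := low_vectors _ _; pose w := (n %/ (a * b))%N.
have wn : (w * (a * b) <= n)%N := leq_divM n (a * b).
have wn' : (w <= n)%N by apply: leq_trans wn; rewrite leq_pmulr.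
have le1 : (#|L| * (2 ^ a) ^ (n - w) <= (2 ^ a + 3) ^ n)%N.
  rewrite -sum_pair_support -sum_nat_const.
  rewrite [X in (_ <= X)%N](bigID (mem L)) /=.
  apply: leq_trans (leq_addr _ _); apply: leq_sum => x; rewrite inE => xL.
  by rewrite leq_pexp2l ?expn_gt0 // leq_sub2l // leq_divRL.
have b0 : (0 < b)%N by move: q0; rewrite muln_gt0 => /andP[].
have le2 : (((2 ^ a + 3) ^ n) ^ b <= 2 ^ ((a * b).+1 * n))%N.
  rewrite -!expnM [(n * b)%N]mulnC !expnM.
  by case: (n) => // n'; rewrite leq_exp2r.
move: le1; rewrite -(leq_exp2r _ _ b0) expnMn => /leq_trans/(_ le2).
rewrite -!expnM => le3; rewrite -(@leq_pmul2r (2 ^ (a * ((n - w) * b)))) ?expn_gt0 //.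
apply: leq_trans le3 _; rewrite -expnD leq_pexp2l //.
(* The exponent 2n is the extra n from the successor in the hypothesis plus the loss
   [w * (a * b) <= n]. *)
have -> : (a * ((n - w) * b) = a * b * n - w * (a * b))%N.
  by rewrite mulnCA mulnBl [(n * _)%N]mulnC.
lia.
Qed.

(** * Union bound over the position and entries of the low rows *)

Lemma leq_card_bigcup (I T : finType) (P : {pred I}) (F : I -> {set T}) :
  (#|\bigcup_(i in P) F i| <= \sum_(i in P) #|F i|)%N.
Proof.
elim/big_rec2: _ => [|i c A _ Ac]; first by rewrite cards0.
by apply: leq_trans (leq_card_setU _ _) _; rewrite leq_add2l.
Qed.

Lemma card_rowsub_preim (T : finType) (m n : nat) (S : {set 'I_m})
  (P : {set 'M[T]_(#|S|, n)}) :
  (#|[set M : 'M[T]_(m, n) | rowsub (@enum_val _ (mem S)) M \in P]|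
     <= #|P| * #|T| ^ ((m - #|S|) * n))%N.
Proof.
apply: card_preim_le => Y _.
have -> : (m - #|S| = #|~: S|)%N by rewrite [in RHS]cardsCs setCK card_ord.
rewrite -card_mx -(@card_in_imset _ _ (rowsub (@enum_val _ (mem (~: S))))).
  exact: max_card.
move=> M M'; rewrite !inE => /eqP eM /eqP eM' eC.
apply/matrixP => i j; have [iS|iS] := boolP (i \in S).
  have /matrixP/(_ (enum_rank_in iS i) j) := etrans eM (esym eM').
  by rewrite !mxE enum_rankK_in.
have {}iS : i \in ~: S by rewrite inE.
have /matrixP/(_ (enum_rank_in iS i) j) := eC.
by rewrite !mxE enum_rankK_in.
Qed.

Definition low_matrices (n q k : nat) : {set 'M[F2]_(k, n + n)} :=
  [set B : 'M[F2]_(k, n + n) | [forall i, (row i B)^T \in low_vectors n q]].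

Lemma card_low_matrices (n q k : nat) :
  (#|low_matrices n q k| <= #|low_vectors n q| ^ k)%N.
Proof.
pose rows (B : 'M[F2]_(k, n + n)) := [ffun i => (row i B)^T].
have rows_inj : injective rows.
  move=> B B' /ffunP eB; apply/row_matrixP => i; apply: trmx_inj.
  by have := eB i; rewrite !ffunE.
rewrite -[X in (_ <= _ ^ X)%N]card_ord -card_ffun_on -(card_imset _ rows_inj).
apply/subset_leq_card/subsetP => g /imsetP[B]; rewrite inE => /forallP lowB ->.
by apply/ffun_onP => i; rewrite ffunE.
Qed.

Definition low_rows (m n q : nat) (B : 'M[F2]_(m, n + n)) : {set 'I_m} :=
  [set i | (row i B)^T \in low_vectors n q].

Definition low_images (m n q : nat) (S : {set 'I_m}) : {set 'M[F2]_(m, n)} :=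
  \bigcup_(B : 'M[F2]_(m, n + n) | low_rows q B == S) isotropic_images B.

(** The rows of the product indexed by S form an isotropic image of a low matrix, which
    [card_isotropic_images] controls; the other rows are left free. *)
Lemma card_low_images (m n q e : nat) (S : {set 'I_m}) :
  (n <= #|S|)%N -> (2 * e <= (#|S| - n) * n)%N ->
  (8 * (e + (#|S| - n) + 1) + 4 * (#|S| - n) <= (#|S| - n) * (#|S| - n))%N ->
  (#|low_images n q S| * 2 ^ e <= #|low_vectors n q| ^ m * 2 ^ (m * n))%N.
Proof.
move=> nS e1 e2.
pose P : {set 'M[F2]_(#|S|, n)} :=
  \bigcup_(B in low_matrices n q #|S|) isotropic_images B.
have leP : (#|P| * 2 ^ e <= #|low_vectors n q| ^ #|S| * 2 ^ (n * #|S|))%N.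
  apply: (@leq_trans (#|low_matrices n q #|S| | * 2 ^ (n * #|S|))%N); last first.
    by rewrite leq_mul2r card_low_matrices orbT.
  apply: leq_trans (leq_mul (leq_card_bigcup _ _) (leqnn _)) _.
  rewrite big_distrl /= -sum_nat_const; apply: leq_sum => B _.
  exact: card_isotropic_images (subnK nS) e1 e2.
have SM : (#|S| <= m)%N by rewrite -[m in (_ <= m)%N]card_ord max_card.
(* The zero vector is low, so the exponent of the number of low vectors may be raised from [#|S|] to
   [m]. *)
have L0 : (0 < #|low_vectors n q|)%N.
  apply/card_gt0P; exists 0; rewrite inE.
  by rewrite [pair_support _](_ : _ = set0) ?cards0 //; apply/setP=> j; rewrite !inE !mxE.
have leT : (#|low_images n q S| <= #|P| * 2 ^ ((m - #|S|) * n))%N.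
  rewrite -[X in (X ^ _)%N]card_F2; apply: leq_trans (card_rowsub_preim P).
  apply/subset_leq_card/subsetP => M /bigcupP[B /eqP BS /imsetP[A isoA ->]].
  rewrite inE; apply/bigcupP; exists (rowsub (@enum_val _ (mem S)) B).
    rewrite inE; apply/forallP=> i.
    have : enum_val i \in low_rows q B by rewrite BS; exact: enum_valP.
    rewrite [enum_val i \in _]inE.
    by rewrite row_rowsub.
  by apply/imsetP; exists A; rewrite // mul_rowsub_mx.
apply: leq_trans (leq_mul leT (leqnn _)) _; rewrite mulnAC.
apply: leq_trans (leq_mul leP (leqnn _)) _; rewrite -mulnA -expnD.
rewrite [X in (_ * 2 ^ X)%N](_ : _ = m * n)%N; last by rewrite mulnC -mulnDl subnKC.
by rewrite leq_mul2r leq_pexp2l ?orbT.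
Qed.

(** A Bernoulli-type induction bounds (1 + 3/N)^b by 1/(1 - 3b/N), which is at most 2. *)
Lemma leq_exp_add3 (N b : nat) : (6 * b <= N -> (N + 3) ^ b <= 2 * N ^ b)%N.
Proof.
have [->|N0] := posnP N; first by case: b.
have step c : (3 * c <= N -> (N + 3) ^ c * (N - 3 * c) <= N ^ c.+1)%N.
  elim: c => [|c IHc] cN; first by rewrite expn0 mul1n expn1; lia.
  have /IHc {}IHc : (3 * c <= N)%N by lia.
  rewrite expnSr -mulnA [X in (_ <= X)%N]expnSr.
  apply: (@leq_trans ((N + 3) ^ c * (N - 3 * c) * N)%N); last first.
    by rewrite leq_mul2r IHc orbT.
  rewrite -mulnA leq_mul2l; apply/orP; right.
  have [d ->] : exists d, N = (3 * c.+1 + d)%N by exists (N - 3 * c.+1)%N; lia.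
  have -> : (3 * c.+1 + d - 3 * c.+1 = d)%N by lia.
  have -> : (3 * c.+1 + d - 3 * c = d + 3)%N by lia.
  lia.
move=> bN; have bN' : (3 * b <= N)%N by lia.
have {}step := step _ bN'.
rewrite -(leq_pmul2r N0) -mulnA -expnSr.
apply: (@leq_trans (2 * ((N + 3) ^ b * (N - 3 * b)))%N); last by rewrite leq_mul2l step orbT.
by rewrite mulnCA leq_mul2l; apply/orP; right; lia.
Qed.

(** The threshold is n + m/D low rows, cleared of its denominator. *)
Definition bad_images (m n q D : nat) : {set 'M[F2]_(m, n)} :=
  \bigcup_(S : {set 'I_m} | (n * D + m < #|S| * D)%N) low_images n q S.

Lemma card_bad_images_exp (m n q D e : nat) :
  (26 * D <= n <= m)%N -> (e * (16 * D ^ 2) <= m * n)%N ->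
  (#|bad_images m n q D| * 2 ^ e
    <= 2 ^ m * (#|low_vectors n q| ^ m * 2 ^ (m * n)))%N.
Proof.
move=> /andP[nD nm] eD; apply: leq_trans (leq_mul (leq_card_bigcup _ _) (leqnn _)) _.
rewrite big_distrl /=.
apply: (@leq_trans (\sum_(S : {set 'I_m} | (n * D + m < #|S| * D)%N)
    #|low_vectors n q| ^ m * 2 ^ (m * n))%N).
  apply: leq_sum => S DS.
  have {}DS : (n * D + m < #|S| * D)%N := DS; have D0 : (0 < D)%N by lia.
  have nS : (n <= #|S|)%N by rewrite -(leq_pmul2r D0) ltnW // (leq_ltn_trans (leq_addr _ _) DS).
  have [s es] : exists s, #|S| = (s + n)%N by exists (#|S| - n)%N; lia.
  have sm : (m < s * D)%N by move: DS; rewrite es mulnDl; lia.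
  (* With [16 * e <= s * s], this leaves half of [s * s], at least 13s, to cover the linear terms
     12s + 8. *)
  have s26 : (26 <= s)%N by rewrite -(leq_pmul2r D0); lia.
  have e16 : (16 * e <= s * s)%N.
    rewrite -(@leq_pmul2r (D ^ 2)) ?expn_gt0 ?D0 //.
    have : (m * n <= (s * D) * (s * D))%N by apply: leq_mul; lia.
    by rewrite -!mulnn in eD *; lia.
  have e2 : (2 * e <= s * n)%N.
    rewrite -(@leq_pmul2r (D ^ 2)) ?expn_gt0 ?D0 //.
    have : (m * n * 1 <= (s * D) * n * D)%N.
      by apply: leq_mul => //; apply: leq_mul => //; lia.
    by rewrite -!mulnn in eD *; lia.
  have e3 : (26 * s <= s * s)%N by rewrite leq_mul2r s26 orbT.
  by apply: card_low_images => //; rewrite es addnK //; lia.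
rewrite sum_nat_cond_const leq_mul2r; apply/orP; right.
apply: leq_trans (max_card _) _.
by rewrite -cardsT -powersetT card_powerset cardsT card_ord.
Qed.

(** The gain [e] is about mn/(16 D^2). With [b] as chosen, the low vectors cost only 2nm/b = mn/(32
    D^2), half of it, and [2 * b <= n] makes the 2^m sets and the target factor 2^n affordable. *)
Lemma card_bad_images (m n D : nat) (b := (64 * D ^ 2)%N) :
  (0 < D)%N -> (2 * b <= n <= m)%N ->
  (#|bad_images m n ((b + 3) * b) D| * 2 ^ n <= 2 ^ (m * n))%N.
Proof.
move=> D0 /andP[bn nm]; set T := #|_|.
have D2 : (0 < D ^ 2)%N by rewrite expn_gt0 D0.
have b0 : (0 < b)%N by rewrite muln_gt0.
have bD : (26 * D <= n)%N by move: bn; rewrite /b -mulnn; nia.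
pose e := (m * n %/ (16 * D ^ 2))%N.
have le1 := @card_bad_images_exp m n ((b + 3) * b) D e.
have {le1}:= le1 _ (leq_divM _ _); rewrite bD nm -/T => /(_ isT).
have ltL : (#|low_vectors n ((b + 3) * b)| ^ b <= 2 ^ (2 * n))%N.
  apply: card_low_vectors; first by rewrite muln_gt0 b0 addn_gt0 b0.
  rewrite expnS expnM leq_exp_add3 // expnD mulnC.
  by have := ltn_expl b (ltnSn 1); lia.
move: #|low_vectors _ _| ltL => L ltL le1.
have e4 : (4 * (m * n) <= e * b + b)%N.
  have := ltn_ceil (m * n) (_ : 0 < 16 * D ^ 2)%N; rewrite muln_gt0 D2 => /(_ isT).
  by rewrite -/e /b; lia.
clearbody b T e.
(* The number of low vectors is bounded only through its [b]-th power, so the whole inequality is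
   raised to that power. *)
rewrite -(leq_exp2r _ _ b0) -(@leq_pmul2r (2 ^ (e * b))) ?expn_gt0 //.
have -> : ((T * 2 ^ n) ^ b * 2 ^ (e * b) = (T * 2 ^ e) ^ b * 2 ^ (n * b))%N.
  by rewrite !expnMn -!expnM mulnAC.
have le2 : ((T * 2 ^ e) ^ b <= 2 ^ (m * b + 2 * n * m + m * n * b))%N.
  apply: (@leq_trans ((2 ^ m * (L ^ m * 2 ^ (m * n))) ^ b)%N).
    by rewrite leq_exp2r.
  rewrite !expnMn -!expnM !expnD mulnA leq_mul2r; apply/orP; right.
  rewrite leq_mul2l [(m * b)%N]mulnC (expnM L) (expnM 2 (2 * n) m); apply/orP; right.
  by have [->|m0] := posnP m; rewrite ?expn0 // leq_exp2r.
apply: leq_trans (leq_mul le2 (leqnn _)) _.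
rewrite -!expnM -!expnD leq_pexp2l //.
have h1 : (2 * b * m <= n * m)%N by rewrite leq_mul2r bn orbT.
have h2 : (2 * b * n <= 2 * b * m)%N by rewrite leq_mul2l nm orbT.
have h3 : (2 * b * 1 <= 2 * b * n)%N by rewrite leq_mul2l; lia.
lia.
Qed.

(** * Expected weight *)

Lemma F2P (c : F2) : c = 0 \/ c = 1.
Proof. by case: c => [[|[|?]]] // ?; [left | right]; apply: val_inj. Qed.

Section ExpectedWeight.
Variable R : realType.
Implicit Types p rho : R.

(** The nontrivial additive character of F2. *)
Definition chi (c : F2) : R := if c == 0 then 1 else -1.

Lemma chiD (a b : F2) : chi (a + b) = chi a * chi b.
Proof.
by case: (F2P a) => ->; case: (F2P b) => ->; rewrite /chi /= ?mulN1r ?mul1r ?opprK.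
Qed.

Lemma neq0_chi (c : F2) : (c != 0)%:R = (1 - chi c) / 2.
Proof. by rewrite /chi; case: eqP => _ /=; lra. Qed.

(** On a pair touched by [b], two of the three nonzero errors flip the sign, giving (1 - p) + p/3 -
    2p/3; an untouched pair gives 1. *)
Lemma expectation_chi p (n : nat) (b : 'rV[F2]_(n + n)) :
  \sum_(e : 'cV[F2]_(n + n)) Dp p e * chi ((b *m e) 0 0)
  = (1 - 4 * p / 3) ^+ #|pair_support b^T|.
Proof.
pose f j (c d : F2) : R :=
  pair_weight p c d * chi (b 0 (lshift n j) * c + b 0 (rshift n j) * d).
transitivity (\sum_(e : 'cV[F2]_(n + n))
    \prod_(j < n) f j (e (lshift n j) 0) (e (rshift n j) 0)).
  apply: eq_bigr => e _; rewrite [RHS]big_split /=; congr (_ * _).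
  rewrite mxE big_split_ord /= -big_split /=.
  exact: (big_morph chi chiD).
rewrite sum_prod_pairs (bigID (mem (pair_support b^T))) /= [X in _ * X]big1.
  rewrite mulr1 (eq_bigr (fun=> 1 - 4 * p / 3)) ?prodr_const // => j.
  rewrite inE !mxE !sum_F2 /f.
  by case: (F2P (b 0 (lshift n j))) => ->; case: (F2P (b 0 (rshift n j))) => ->;
     rewrite /pair_weight /chi //= => _; lra.
move=> j; rewrite inE !mxE negb_or !negbK => /andP[/eqP b1 /eqP b2].
by rewrite !sum_F2 /f b1 b2 !mul0r addr0 /pair_weight /chi /=; lra.
Qed.

Lemma sum_Dp p (n : nat) : \sum_(e : 'cV[F2]_(n + n)) Dp p e = 1.
Proof.
have := expectation_chi p (0 : 'rV[F2]_(n + n)).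
rewrite [pair_support _](_ : _ = set0) ?cards0; last first.
  by apply/setP=> j; rewrite !inE !mxE.
by rewrite expr0 => <-; apply: eq_bigr => e _; rewrite mul0mx mxE /chi eqxx mulr1.
Qed.

Lemma exp_weightE p (m n : nat) (B : 'M[F2]_(m, n + n)) :
  exp_weight p B
  = \sum_(i < m) (1 - (1 - 4 * p / 3) ^+ #|pair_support (row i B)^T|) / 2.
Proof.
transitivity (\sum_(e : 'cV[F2]_(n + n)) \sum_(i < m)
    Dp p e * ((1 - chi ((row i B *m e) 0 0)) / 2)).
  apply: eq_bigr => e _; rewrite /hamming -sum1_card natr_sum -mulr_sumr; congr (_ * _).
  rewrite big_mkcond /=; apply: eq_bigr => i _; rewrite -neq0_chi inE.
  by rewrite -row_mul !mxE; case: eqP.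
rewrite exchange_big /=; apply: eq_bigr => i _.
rewrite -expectation_chi -[X in (X - _) / 2](sum_Dp p n) -sumrB mulr_suml.
by apply: eq_bigr => e _; ring.
Qed.

(** Induction on (1 - x)(1 + (w+1)x) = 1 + wx - (w+1)x^2. *)
Lemma expr_1B_le (x : R) (w : nat) : 0 <= x <= 1 -> (1 - x) ^+ w * (1 + w%:R * x) <= 1.
Proof.
move=> x01; elim: w => [|w IHw]; first by rewrite expr0; lra.
apply: le_trans IHw; rewrite exprSr -mulrA ler_wpM2l ?exprn_ge0 //; first lra.
have : 0 <= w%:R * x ^+ 2 :> R by rewrite mulr_ge0 // sqr_ge0.
by rewrite -natr1 expr2; nra.
Qed.

(** For p above 3/4 the base is negative, hence the absolute value and the weaker rate p/3, valid on
    all of [0,1]. *)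
Lemma norm_chi_decay p : 0 <= p <= 1 -> `|1 - 4 * p / 3| <= 1 - p / 3.
Proof. by move=> p01; rewrite ler_norml; apply/andP; split; lra. Qed.

(** Since w exceeds n/q, the product wp/3 is at least 1/rho, and [expr_1B_le] bounds the power by
    1/(1 + wp/3). *)
Lemma chi_decay p rho (n q w : nat) :
  0 <= p <= 1 -> 0 < rho -> 3 * q%:R / rho <= p * n%:R -> (n < w * q)%N ->
  (1 - 4 * p / 3) ^+ w <= rho.
Proof.
move=> p01 rho0 pn nwq.
have q0 : 0 < q%:R :> R by rewrite ltr0n; case: q nwq {pn} => //; rewrite muln0.
apply: le_trans (ler_norm _) _; rewrite normrX.
apply: le_trans (_ : (1 - p / 3) ^+ w <= _).
  by apply: lerXn2r; rewrite ?nnegrE ?norm_chi_decay //; lra.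
have := @expr_1B_le (p / 3) w; have -> : 0 <= p / 3 <= 1 by lra.
move=> /(_ isT); set y := _ ^+ w => le1.
have y0 : 0 <= y by rewrite exprn_ge0 //; lra.
have le2 : 1 <= w%:R * (p / 3) * rho.
  have : n%:R <= w%:R * q%:R :> R by rewrite -natrM ler_nat ltnW.
  move=> nw; have : 3 * q%:R <= p * (w%:R * q%:R) * rho.
    by rewrite -ler_pdivrMr //; apply: le_trans pn _; rewrite ler_wpM2l //; lra.
  move=> h; rewrite -(ler_pM2r q0).
  have -> : w%:R * (p / 3) * rho * q%:R = p * (w%:R * q%:R) * rho / 3 by ring.
  lra.
have : y * (w%:R * (p / 3)) <= 1 by nra.
rewrite -(ler_pM2r rho0) => le3.
have : y * 1 <= y * (w%:R * (p / 3) * rho) by rewrite ler_wpM2l.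
lra.
Qed.

Lemma exp_weight_ge p rho (m n q : nat) (B : 'M[F2]_(m, n + n)) :
  0 <= p <= 1 -> 0 < rho -> 3 * q%:R / rho <= p * n%:R ->
  (m%:R - #|low_rows q B|%:R) * ((1 - rho) / 2) <= exp_weight p B.
Proof.
move=> p01 rho0 pn; rewrite exp_weightE (bigID (mem (low_rows q B))) /=.
rewrite -[X in X <= _]add0r lerD //.
  apply: sumr_ge0 => i _; rewrite divr_ge0 // subr_ge0.
  apply: le_trans (ler_norm _) _; rewrite normrX exprn_ile1 //.
  by apply: le_trans (norm_chi_decay p01) _; lra.
have -> : m%:R - #|low_rows q B|%:R = #|[predC low_rows q B]|%:R :> R.
  rewrite -[X in X%:R - _]card_ord -(cardC (mem (low_rows q B))).
  by rewrite natrD addrAC subrr add0r.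
rewrite mulrC mulr_natr -sumr_const; apply: ler_sum => i.
rewrite !inE -ltnNge => /(chi_decay p01 rho0 pn) le1.
by move: (_ ^+ _) le1 => y le1; lra.
Qed.

End ExpectedWeight.

(** * Total variation distance *)

Section TotalVariation.
Variable R : realType.

Lemma fullrank_isotropic_exists (n : nat) :
  exists A : 'M[F2]_(n + n, n), fullrank_isotropic A.
Proof.
exists (col_mx 1%:M 0); apply/fullrank_isotropicP; split.
  by rewrite rank_col_mx0 mxrank1.
rewrite tr_col_mx trmx1 trmx0 mul_row_block !mulmx0 !mul0mx !mul1mx ?addr0 ?add0r.
by rewrite mul_row_col ?mul0mx ?mulmx0 ?addr0.
Qed.

Lemma unif_iso_ge0 (n : nat) (A : 'M[F2]_(n + n, n)) : 0 <= unif_iso R A.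
Proof. by rewrite /unif_iso; case: ifP => // _; rewrite invr_ge0 ler0n. Qed.

Lemma sum_unif_iso (n : nat) :
  \sum_(A : 'M[F2]_(n + n, n) | fullrank_isotropic A) unif_iso R A = 1.
Proof.
rewrite /unif_iso (eq_bigr (fun=> (#|[set A' : 'M[F2]_(n + n, n) | fullrank_isotropic A']|%:R)^-1)).
  rewrite sumr_const -[LHS]mulr_natr cardsE mulVf // pnatr_eq0 -lt0n.
  by have [A isoA] := fullrank_isotropic_exists n; apply/card_gt0P; exists A.
by move=> A ->.
Qed.

(** The difference over E is bounded by the full l1 norm, which is twice [tvd]. *)
Lemma sum_le_tvd (T : finType) (P Q : T -> R) (E : {set T}) :
  \sum_(x in E) P x <= \sum_(x in E) Q x + 2 * tvd P Q.
Proof.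
rewrite -lerBlDl -sumrB /tvd mulrA divff ?pnatr_eq0 // mul1r.
rewrite [X in _ <= X](bigID (mem E)) /= -[X in X <= _]addr0 lerD //.
  by apply: ler_sum => x _; rewrite ler_norm.
exact: sumr_ge0.
Qed.

(** The mass of each bad B is spread over all isotropic A by independence, and every resulting
    product lands in T. *)
Lemma prob_le_law_BA (m n : nat) (PB : {ffun 'M[F2]_(m, n + n) -> R})
  (bad : pred 'M[F2]_(m, n + n)) (T : {set 'M[F2]_(m, n)}) :
  is_distr PB ->
  (forall B A, bad B -> fullrank_isotropic A -> B *m A \in T) ->
  \sum_(B | bad B) PB B <= \sum_(M in T) law_BA PB M.
Proof.
move=> [PB0 _] badT; rewrite /law_BA exchange_big /= big_mkcond /=.
apply: ler_sum => B _; rewrite exchange_big /=.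
have term_ge0 A M : 0 <= PB B * unif_iso R A * (B *m A == M)%:R.
  by rewrite mulr_ge0 // mulr_ge0 ?unif_iso_ge0.
case: ifP => [badB|_]; last first.
  by apply: sumr_ge0 => M _; apply: sumr_ge0 => A _.
rewrite -[X in X <= _]mulr1 -[X in _ * X <= _](sum_unif_iso n) mulr_sumr big_mkcond /=.
apply: ler_sum => A _; case: ifP => [isoA|_]; last exact: sumr_ge0.
by rewrite (bigD1 (B *m A)) ?badT //= eqxx mulr1 lerDl; apply: sumr_ge0.
Qed.

Lemma prob_le_tvd (m n : nat) (PB : {ffun 'M[F2]_(m, n + n) -> R})
  (bad : pred 'M[F2]_(m, n + n)) (T : {set 'M[F2]_(m, n)}) :
  is_distr PB ->
  (forall B A, bad B -> fullrank_isotropic A -> B *m A \in T) ->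
  \sum_(B | bad B) PB B <=
    #|T|%:R / #|{: 'M[F2]_(m, n)}|%:R
    + 2 * tvd (law_BA PB) (fun=> (#|{: 'M[F2]_(m, n)}|%:R)^-1).
Proof.
move=> PBd badT; apply: le_trans (prob_le_law_BA PBd badT) _.
by apply: le_trans (sum_le_tvd _ (fun=> (#|{: 'M[F2]_(m, n)}|%:R)^-1) _) _; rewrite sumr_const -[_ *+ #|T|]mulr_natl.
Qed.

End TotalVariation.

(** For positive k and c the quotient of n by 2k, n is at most 2k(c+1), hence at most (c+1)^2 and so
    2^(2c); the k-th power is at most 2^(2kc). *)
Lemma expn_le_exp2 (k n : nat) : ((2 * k) ^ 2 <= n)%N -> (n ^ k <= 2 ^ n)%N.
Proof.
case: k => [|k] kn; first by rewrite expn0 expn_gt0.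
pose c := (n %/ (2 * k.+1))%N.
have k0 : (0 < 2 * k.+1)%N by [].
have nc : (n < c.+1 * (2 * k.+1))%N := ltn_ceil n k0.
have cn : (c * (2 * k.+1) <= n)%N := leq_divM n _.
have kc : (2 * k.+1 <= c.+1)%N.
  by rewrite ltnW // ltnS leq_divRL // mulnn.
apply: leq_trans (_ : (2 ^ c) ^ (2 * k.+1) <= _)%N; last first.
  by rewrite -expnM leq_pexp2l.
rewrite expnM leq_exp2r //; apply: leq_trans (ltnW nc) _.
by rewrite -mulnn; apply: leq_mul; rewrite ?(leq_trans kc) // ltn_expl.
Qed.

(** * Negligibility *)

Definition many_low_rows (m n q D : nat) (B : 'M[F2]_(m, n + n)) : bool :=
  (n * D + m < #|low_rows q B| * D)%N.

Lemma prob_many_low_rows (R : realType) (m n D : nat) (b := (64 * D ^ 2)%N)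
  (PB : {ffun 'M[F2]_(m, n + n) -> R}) :
  is_distr PB -> (0 < D)%N -> (2 * b <= n <= m)%N ->
  \sum_(B | many_low_rows ((b + 3) * b) D B) PB B <=
    (2 ^+ n)^-1 + 2 * tvd (law_BA PB) (fun=> (#|{: 'M[F2]_(m, n)}|%:R)^-1).
Proof.
move=> PBd D0 bnm; set q := ((b + 3) * b)%N.
apply: le_trans (_ : #|bad_images m n q D|%:R / #|{: 'M[F2]_(m, n)}|%:R
    + 2 * tvd (law_BA PB) (fun=> (#|{: 'M[F2]_(m, n)}|%:R)^-1) <= _).
  apply: prob_le_tvd => // B A lowB isoA; apply/bigcupP; exists (low_rows q B) => //.
  by apply/bigcupP; exists B; rewrite ?eqxx //; apply/imsetP; exists A; rewrite ?inE.
rewrite lerD2r card_mx card_F2 ler_pdivrMr ?ltr0n ?expn_gt0 //.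
rewrite mulrC ler_pdivlMr ?exprn_gt0 // -natrX -natrM ler_nat.
exact: card_bad_images.
Qed.

Lemma negligible_bound (R : realType) (f g : nat -> R) (N : nat) :
  negligible g ->
  (forall n, (N <= n)%N -> `|f n| <= (2 ^+ n)^-1 + 2 * g n) ->
  negligible f.
Proof.
(* One spare power of n absorbs the constant 3 = 1 + 2 once n is at least 3. *)
move=> negl_g fg k; have [N1 gN1] := negl_g k.+1.
exists (maxn (maxn N N1) (maxn 3 ((2 * k.+1) ^ 2))) => n.
rewrite !geq_max => /andP[/andP[nN nN1] /andP[n3 nk]].
have n0 : 0 < n%:R :> R by rewrite ltr0n; lia.
have nk0 : 0 < n%:R ^+ k.+1 :> R by rewrite exprn_gt0.
have le1 : (2 ^+ n)^-1 <= (n%:R ^+ k.+1)^-1 :> R.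
  by rewrite lef_pV2 ?posrE ?exprn_gt0 // -!natrX ler_nat expn_le_exp2.
have le2 : g n <= (n%:R ^+ k.+1)^-1 by apply: le_trans (ler_norm _) (gN1 n nN1).
apply: le_trans (fg n nN) _; apply: le_trans (_ : 3 * (n%:R ^+ k.+1)^-1 <= _).
  by lra.
rewrite ler_pdivrMr // exprSr mulrA mulVf ?mul1r ?ler_nat //.
by rewrite lt0r_neq0 // exprn_gt0.
Qed.

Theorem theoremD2 (R : realType) (m : nat -> nat) (p : nat -> R)
  (PB : forall n : nat, {ffun 'M[F2]_(m n, n + n) -> R}) (delta : R) :
  poly_bounded m ->
  (exists c : R, 1 < c /\ forall n : nat, c * n%:R < (m n)%:R) ->
  (forall n : nat, 0 <= p n <= 1) ->
  omega_inv_n p ->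
  (forall n : nat, is_distr (PB n)) ->
  negligible (fun n : nat =>
    tvd (law_BA (PB n)) (fun _ : 'M[F2]_(m n, n) => (#|{: 'M[F2]_(m n, n)}|%:R)^-1)) ->
  0 < delta ->
  exists eps : nat -> R, negligible eps /\
    forall n : nat,
      1 - eps n <=
      \sum_(B : 'M[F2]_(m n, n + n))
        PB n B * ((1 - n%:R / (m n)%:R - delta) / 2 * (m n)%:R
                   <= exp_weight (p n) B)%R%:R.
Proof.
move=> _ [c [c1 cm]] p01 pomega PBd negl_tvd delta0.
(* The slack [delta] is split in two: [D] makes m/D less than (delta/2)m, and [rho] takes the other
   half. *)
pose D := Num.bound (2 / delta).
have Dge : 2 / delta < D%:R by rewrite archi_boundP // divr_ge0 // ltW.
have D0 : (0 < D)%N by rewrite -(ltr0n R) (le_lt_trans _ Dge) // divr_ge0 // ltW.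
pose b := (64 * D ^ 2)%N; pose q := ((b + 3) * b)%N.
pose rho := delta / 2; have rho0 : 0 < rho by rewrite divr_gt0.
have [N1 pN1] := pomega (3 * q%:R / rho).
pose ok n (B : 'M[F2]_(m n, n + n)) : bool :=
  (1 - n%:R / (m n)%:R - delta) / 2 * (m n)%:R <= exp_weight (p n) B.
(* The witness is the failure probability itself, so only its negligibility remains. *)
exists (fun n => 1 - \sum_B PB n B * (ok n B)%:R); split; last first.
  by move=> n; rewrite opprB addrC subrK.
have nm n : (n <= m n)%N.
  rewrite -(ler_nat R) ltW // (le_lt_trans _ (cm n)) //.
  by rewrite -[X in X <= _]mul1r ler_wpM2r // ltW.
apply: (negligible_bound (N := maxn N1 (2 * b)) negl_tvd) => n.
rewrite geq_max => /andP[nN1 nb]; have [PB0 PB1] := PBd n.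
rewrite ger0_norm; last first.
  rewrite -[X in X - _]PB1 -sumrB; apply: sumr_ge0 => B _.
  rewrite mulr_natr; case: (ok n B); first by rewrite mulr1n subrr.
  by rewrite mulr0n subr0 PB0.
apply: le_trans (prob_many_low_rows (PBd n) D0 _); last by rewrite nb nm.
rewrite -[X in X - _]PB1 -sumrB [X in _ <= X]big_mkcond /=; apply: ler_sum => B _.
case: ifPn => [_|]; first by rewrite lerBlDr lerDl mulr_ge0.
rewrite /many_low_rows -leqNgt -/b -/q => few.
suff -> : ok n B by rewrite mulr1 subrr.
have m0 : 0 < (m n)%:R :> R.
  by apply: le_lt_trans (cm n); rewrite mulr_ge0 // ltW // (lt_trans ltr01).
apply: le_trans (exp_weight_ge B (p01 n) rho0 (pN1 n nN1)).
have -> : (1 - n%:R / (m n)%:R - delta) / 2 * (m n)%:R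
  = ((m n)%:R - n%:R - delta * (m n)%:R) / 2.
  by field; rewrite gt_eqF.
have S0 : 0 <= #|low_rows q B|%:R :> R by [].
have {few} : #|low_rows q B|%:R * D%:R <= n%:R * D%:R + (m n)%:R :> R.
  by rewrite -!natrM -natrD ler_nat.
move: #|low_rows q B|%:R S0 => S S0 few.
have D0' : 0 < D%:R :> R by rewrite ltr0n.
have {few} few : S <= n%:R + delta / 2 * (m n)%:R.
  rewrite -(ler_pM2r D0'); apply: le_trans few _; rewrite mulrDl lerD2l.
  have : 2 < D%:R * delta by rewrite -ltr_pdivrMr.
  by nra.
(* Expanding (m - S)(1 - delta/2), the term (delta/2)S is dropped as nonnegative, so [delta] above 2
   is no special case. *)
by rewrite /rho; nra.
Qed.
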